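(* Let $n>0$ and let $\alpha=(\alpha_1,\alpha_2,\ldots,\alpha_r)$ be a composition of $n$. The poset of join-irreducible elements of $\mathrm{Tam}(\alpha)$ (with the order induced from $\mathrm{Tam}(\alpha)$) consists of $r-1$ connected components, where for $j\in\{1,\ldots,r-1\}$ the $j$-th component is isomorphic to the direct product of an $\alpha_j$-chain and an $(\alpha_{j+1}+\alpha_{j+2}+\cdots+\alpha_r)$-chain.
   Context: Let $n>0$ and let $\alpha=(\alpha_1,\ldots,\alpha_r)$ be a composition of $n$ (a sequence of positive integers with sum $n$). Put $[n]=\{1,\ldots,n\}$, $p_0=0$ and $p_i=\alpha_1+\cdots+\alpha_i$. The $i$-th $\alpha$-region is $\{p_{i-1}+1,\ldots,p_i\}$. For $w$ in the symmetric group $\mathfrak{S}_n$ write $w_i=w(i)$ and $\mathrm{Inv}(w)=\{(i,j): i<j,\ w_i>w_j\}$. The (left) weak order on $\mathfrak{S}_n$ is $u\leq_L v$ iff $\mathrm{Inv}(u)\subseteq\mathrm{Inv}(v)$. Let $\mathfrak{S}_\alpha$ be the set of $w\in\mathfrak{S}_n$ with $w_i<w_{i+1}$ for all $i\in[n-1]\setminus\{p_1,\ldots,p_{r-1}\}$. An $(\alpha,231)$-pattern in $w\in\mathfrak{S}_\alpha$ is a triple $(i,j,k)$ with $i<j<k$ all in different $\alpha$-regions such that $w_k<w_i<w_j$ and $w_i=w_k+1$. Let $\mathfrak{S}_\alpha(231)$ be the set of $w\in\mathfrak{S}_\alpha$ having no $(\alpha,231)$-pattern, and let $\mathrm{Tam}(\alpha)$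 be the poset $(\mathfrak{S}_\alpha(231),\leq_L)$; it is a finite lattice. An element $j$ of a finite lattice, different from the least element, is join irreducible if $j=a\vee b$ implies $j\in\{a,b\}$. A $k$-chain is a totally ordered set with $k$ elements. *)

(* Defs.v *)
From HB Require Import structures.
From mathcomp Require Import all_boot all_order all_fingroup.

Set Implicit Arguments.
Unset Strict Implicit.
Unset Printing Implicit Defensive.

Import Order.TTheory.

Section PosetNotions.
Local Open Scope order_scope.
Context {d : Order.disp_t} {T : finPOrderType d}.
Implicit Types x a b : T.

Definition is_least x : bool := [forall y : T, x <= y].

(* x is the join of a and b, stated as a least upper bound so that no lattice
   structure on T has to be supplied. *)
Definition is_join x a b : bool :=
  [&& a <= x, b <= x & [forall y : T, (a <= y) && (b <= y) ==> (x <= y)]].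

Definition join_irreducible x : bool :=
  ~~ is_least x &&
  [forall a : T, forall b : T, is_join x a b ==> (x == a) || (x == b)].

(* Vertex sets of the connected components of the comparability graph of T
   (equivalently, as T is finite, of its Hasse diagram). *)
Definition components : {set {set T}} :=
  equivalence_partition (connect (fun x y : T => x >=< y)) [set: T].

End PosetNotions.

Arguments components {d} T.

Record JI (d : Order.disp_t) (T : finPOrderType d) : Type :=
  MkJI { JI_val : T; _ : join_irreducible JI_val }.

Section JIPoset.
Context (d : Order.disp_t) (T : finPOrderType d).

HB.instance Definition _ := [isSub for @JI_val d T].
HB.instance Definition _ := [Finite of JI T by <:].
HB.instance Definition _ := [SubChoice_isSubPOrder of JI T by <: with d].

End JIPoset.

(* The subset C of T', with the induced order, is isomorphic to T. *)
Definition isomorphic_to_subset (d d' : Order.disp_t)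
    (T : finPOrderType d) (T' : finPOrderType d') (C : {set T'}) : Prop :=
  exists f : T -> T', {mono f : x y / (x <= y)%O} /\ [set f x | x : T] = C.

(* Positions and values are 0-based: the element i of 'I_n stands for i + 1 in
   {1, ..., n}, and a < size alpha indexes the (a + 1)-st part of alpha. *)

Definition is_composition (n : nat) (alpha : seq nat) : bool :=
  all (leq 1) alpha && (sumn alpha == n).

(* p_a = alpha_1 + ... + alpha_a *)
Definition psum (alpha : seq nat) (a : nat) : nat := sumn (take a alpha).

Section ParabolicTamari.
Context {n : nat} (alpha : seq nat).
Implicit Types (w : 'S_n) (i j k : 'I_n).

Definition region (a : nat) : {set 'I_n} :=
  [set i : 'I_n | psum alpha a <= i < psum alpha a.+1].

Definition different_regions i j : bool :=
  [forall a : 'I_(size alpha), ~~ ((i \in region a) && (j \in region a))].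

Definition Inv w : {set 'I_n * 'I_n} :=
  [set p : 'I_n * 'I_n | (p.1 < p.2) && (w p.2 < w p.1)].

(* For consecutive 0-based positions i and j = i + 1, the 1-based number of
   position i is the value of j; it is this number that must avoid
   p_1, ..., p_(r-1). *)
Definition parabolic w : bool :=
  [forall i : 'I_n, forall j : 'I_n,
    (j == i.+1 :> nat) &&
    (val j \notin [seq psum alpha a | a <- iota 1 (size alpha).-1])
    ==> (w i < w j)].

Definition pattern231 w i j k : bool :=
  [&& i < j, j < k,
      different_regions i j, different_regions j k, different_regions i k,
      w k < w i, w i < w j & w i == (w k).+1 :> nat].

Definition avoids231 w : bool :=
  [forall i : 'I_n, forall j : 'I_n, forall k : 'I_n, ~~ pattern231 w i j k].

End ParabolicTamari.

Record Tam (n : nat) (alpha : seq nat) : Type :=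
  MkTam { Tam_val :> 'S_n; _ : parabolic alpha Tam_val && avoids231 alpha Tam_val }.

HB.instance Definition _ (n : nat) (alpha : seq nat) :=
  [isSub for @Tam_val n alpha].
HB.instance Definition _ (n : nat) (alpha : seq nat) :=
  [Finite of Tam n alpha by <:].

Lemma Inv_inj (n : nat) : injective (@Inv n).
Proof.
move=> u v uv; apply/permP=> i; apply: val_inj.
have rankE (w : 'S_n) : val (w i) = #|[set j | w j < w i]|.
  rewrite -[RHS](card_imset _ (@perm_inj _ w)).
  have -> : w @: [set j | w j < w i] = [set k : 'I_n | k < w i].
    apply/setP=> k; rewrite inE; apply/imsetP/idP=> [[j + ->]|ki].
      by rewrite inE.
    by exists ((w^-1)%g k); rewrite ?inE permKV.
  have win : w i <= n by exact: ltnW.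
  by rewrite cardsE -sum1_card -(big_ord_widen _ (fun=> 1) win) sum1_card card_ord.
rewrite (rankE u) (rankE v); congr #|pred_of_set _|; apply/setP=> j; rewrite !inE.
have := uv; move/setP=> {}uv.
have [ij|ji|/val_inj->] := ltngtP i j; last by rewrite !ltnn.
  by have := uv (i, j); rewrite !inE /= ij.
have := uv (j, i); rewrite !inE /= ji /= => E.
have ltNge (w : 'S_n) : (w j < w i) = ~~ (w i < w j).
  rewrite -leqNgt ltn_neqAle; case: eqP => // /val_inj/perm_inj eji.
  by rewrite eji ltnn in ji.
by rewrite !ltNge E.
Qed.

Fact Tam_display : Order.disp_t. Proof. exact: (Order.Disp tt tt). Qed.

Section WeakOrder.
Variables (n : nat) (alpha : seq nat).
Implicit Types u v : Tam n alpha.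

Definition weak_le u v : bool := Inv (val u) \subset Inv (val v).

Lemma weak_le_refl : reflexive weak_le.
Proof. by move=> u; apply: subxx. Qed.

Lemma weak_le_anti : antisymmetric weak_le.
Proof. by move=> u v; rewrite -eqEsubset => /eqP/Inv_inj/val_inj. Qed.

Lemma weak_le_trans : transitive weak_le.
Proof. by move=> v u w; apply: subset_trans. Qed.

HB.instance Definition _ :=
  Order.Le_isPOrder.Build Tam_display (Tam n alpha)
    weak_le_refl weak_le_anti weak_le_trans.

End WeakOrder.

(* Main.v *)
Require Import Defs.
From HB Require Import structures.
From mathcomp Require Import all_boot all_order all_fingroup.
From mathcomp Require Import zify.

Set Implicit Arguments.
Unset Strict Implicit.
Unset Printing Implicit Defensive.

(** Call a pair (i, k) of positions a descent of w if i < k and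
    w i = w k + 1, and for positions i, k with i in an earlier region than k
    let [rect i k] be the set of pairs (x, y) such that x runs from i to the end
    of the region of i and y runs from the start of the next region to k.  The
    theorem holds because the join irreducibles of Tam(alpha) are exactly the
    elements whose inversion set is such a rectangle.  Granting this, the order
    is inclusion of rectangles: two rectangles whose corners i lie in different
    regions are disjoint, while for i in a fixed region j one has
    [rect i k \subset rect i' k'] iff i' <= i and k <= k'.  The first coordinate
    ranges over the alpha_j positions of region j, read from right to left, and
    the second over all the positions after region j.

    The avoidance condition makes each element x the join of its descent
    rectangles: if (i, k) is a descent of x then [rect i k] consists of
    inversions of x ([rect_descent]), and a permutation whose inversion set
    contains all descent rectangles of x lies above x ([Inv_sub_of_descents]).
    Moreover exchanging the values at a descent removes exactly one inversion,
    and below the resulting permutation there is a greatest element of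
    Tam(alpha) ([exists_greatest_avoiding]).

    If x has two distinct descents d and d', let u and u' be these greatest
    elements for d and d'.  Neither descent lies in the rectangle of another one
    ([descents_rect]), so u is above the rectangles of all descents except d, and
    u' above those of all descents except d'.  Hence x is the join of u and u',
    both different from x, and x is not join irreducible.  So a join irreducible
    has a single descent (i, k), and its inversion set is [rect i k].

    Conversely let [Inv x = rect i k].  An element below x that inverts i and k
    inverts the whole rectangle ([rect_sub_of_corner]), hence equals x; so all
    elements strictly below x lie below the greatest element u attached to the
    descent (i, k), and x is not a join of two of them. *)

(** * Inversions and adjacent values *)

Lemma in_Inv n (w : 'S_n) (i k : 'I_n) :
  ((i, k) \in Inv w) = (i < k) && (w k < w i).
Proof. by rewrite inE. Qed.

Lemma Inv_transitive n (w : 'S_n) (i l k : 'I_n) :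
  (i, l) \in Inv w -> (l, k) \in Inv w -> (i, k) \in Inv w.
Proof. by rewrite !in_Inv; lia. Qed.

Lemma perm_neq n (w : 'S_n) (i k : 'I_n) : i != k :> nat -> w i != w k :> nat.
Proof. by apply: contraNN => /eqP/val_inj/perm_inj->. Qed.

Lemma Inv_tperm n (w : 'S_n) (i k : 'I_n) :
  i < k -> w i = (w k).+1 :> nat -> Inv (tperm i k * w)%g = Inv w :\ (i, k).
Proof.
move=> ik wik; apply/setP=> -[x y]; rewrite in_setD1 !in_Inv xpair_eqE !permM.
have [xy /=|] := ltnP x y; last by rewrite andbF.
have wx_i := @perm_neq _ w x i; have wx_k := @perm_neq _ w x k.
have wy_i := @perm_neq _ w y i; have wy_k := @perm_neq _ w y k.
have swapE z : w (tperm i k z) =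
    (if z == i :> nat then w k else if z == k :> nat then w i else w z) :> nat.
  case: tpermP => [->|->|/eqP/negPf zi /eqP/negPf zk].
  - by rewrite eqxx.
  - by rewrite eqxx; case: ifP => // /eqP/val_inj->.
  - by rewrite !(inj_eq val_inj) zi zk.
rewrite !swapE -!(inj_eq val_inj) /=.
have [/val_inj ?|xi] := eqVneq (x : nat) i; [subst x|];
  have [/val_inj ?|yi] := eqVneq (y : nat) i; try (subst y);
  try (have [/val_inj ?|xk] := eqVneq (x : nat) k); try (subst x);
  try (have [/val_inj ?|yk] := eqVneq (y : nat) k); try (subst y);
  rewrite /= ?eqxx /=; lia.
Qed.

(** * Descents and rectangles *)

(** The regions enter only through a weakly increasing function [reg] sending a
    position to the index of its region. *)

Section Regions.
Variables (n : nat) (reg : 'I_n -> nat).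
Hypothesis reg_mono : forall i k : 'I_n, i <= k -> reg i <= reg k.
Implicit Types (w u v : 'S_n) (i j k l : 'I_n).

(** Membership in the parabolic quotient: positions of one region are never
    inverted. *)
Definition increasing w := forall i k, (i, k) \in Inv w -> reg i < reg k.

Definition avoiding w := forall i j k,
  reg i < reg j -> reg j < reg k -> w i = (w k).+1 :> nat -> w j <= w i.

Definition rect i k : {set 'I_n * 'I_n} :=
  [set p : 'I_n * 'I_n |
    [&& i <= p.1, p.2 <= k, reg p.1 == reg i & reg i < reg p.2]].

Lemma reg_lt i k : reg i < reg k -> i < k.
Proof. by move=> rik; rewrite ltnNge; apply/negP => /reg_mono; lia. Qed.

Lemma mem_rect i k x y :
  ((x, y) \in rect i k) =
    [&& i <= x, y <= k, reg x == reg i & reg i < reg y].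
Proof. by rewrite inE. Qed.

Lemma corner_rect i k : ((i, k) \in rect i k) = (reg i < reg k).
Proof. by rewrite mem_rect !leqnn eqxx. Qed.

Lemma rect_subset i k i' k' : reg i < reg k -> reg i = reg i' ->
  (rect i k \subset rect i' k') = (i' <= i) && (k <= k').
Proof.
move=> rik ri; apply/subsetP/andP => [/(_ (i, k))|[i'i kk'] [x y]].
  by rewrite corner_rect rik mem_rect => /(_ isT)/and4P[].
by rewrite !mem_rect ri; lia.
Qed.

(** Induction on the difference of the values at an inversion (i, k).  If some
    position strictly between i and k carries an intermediate value, (i, k) is
    obtained by transitivity from two inversions with smaller differences.
    Otherwise all intermediate values sit before i or after k; reading the values
    upwards from [u k] (at position k) to [u i] (at position i), there is a step
    from a position k' >= k to a position i' <= i, which is a descent.  As u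
    avoids the pattern (i', i, k'), the positions i' and i share their region, so
    (i, k) lies in [rect i' k']. *)
Lemma Inv_sub_of_descents u v : increasing u -> avoiding u ->
    (forall i k, i < k -> u i = (u k).+1 :> nat -> rect i k \subset Inv v) ->
  Inv u \subset Inv v.
Proof.
move=> u_inc u_av u_v; apply/subsetP => -[i k].
have [m] := ubnP (u i - u k); elim: m => // m IHm in i k *; rewrite ltnS => gap.
move=> ik_u; have:= ik_u; rewrite in_Inv => /andP[ik uki].
have [/existsP[l /and4P[il lk ukl uli]] | /existsPn between] :=
    boolP [exists l : 'I_n, [&& i < l, l < k, u k < u l & u l < u i]].
  by apply: (@Inv_transitive _ _ i l k); apply: IHm; rewrite ?in_Inv; lia.
(* i' carries the least value above u k found at or before i, and k' the
   value just below. *)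
pose P l := (l <= i) && (u k < u l).
have Pi : P i by rewrite /P leqnn.
case: (arg_minnP (fun l => nat_of_ord (u l)) Pi) => i' /andP[i'i uki'] min_i'.
have ltn : (u i').-1 < n by have := ltn_ord (u i'); lia.
pose k' := (u^-1)%g (Ordinal ltn).
have uk' : u k' = (u i').-1 :> nat by rewrite /k' permKV.
have {uk'} i'k' : u i' = (u k').+1 :> nat by rewrite uk'; lia.
clearbody k'.
have ik' : i < k'.
  rewrite ltnNge; apply/negP => k'i.
  have [ukk'|] := ltnP (u k) (u k').
    by have := min_i' k'; rewrite /P k'i ukk'; lia.
  have := @perm_neq _ u k k'; have := reg_mono k'i; lia.
have ui'i : u i' <= u i by apply: min_i'.
have kk' : k <= k'.
  rewrite leqNgt; apply/negP => k'k; have := between k'; rewrite ik' k'k /=.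
  by have := @perm_neq _ u k k'; lia.
have rik : reg i < reg k by apply: u_inc.
have rkk' := reg_mono kk'.
have ri'i : reg i = reg i'.
  apply/eqP; rewrite eqn_leq (reg_mono i'i) andbT leqNgt; apply/negP => ri'i.
  have := u_av i' i k' ri'i (leq_trans rik rkk') i'k'.
  have := @perm_neq _ u i i'; have := reg_lt ri'i; lia.
have i'k'lt : i' < k' by lia.
by apply: (subsetP (u_v i' k' i'k'lt i'k')); rewrite mem_rect; lia.
Qed.

Lemma increasing_le w i k :
  increasing w -> i <= k -> reg i = reg k -> w i <= w k.
Proof.
move=> w_inc ik rik; rewrite leqNgt; apply/negP => wki.
have /w_inc : (i, k) \in Inv w.
  rewrite in_Inv wki andbT ltn_neqAle ik andbT.
  by apply: contraTN wki => /eqP/val_inj->; rewrite ltnn.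
by rewrite rik ltnn.
Qed.

(** A position y in a region strictly between those of i and k cannot carry a
    value above [w i], for otherwise (i, y, k) would be a pattern. *)
Lemma rect_descent w i k : increasing w -> avoiding w ->
  i < k -> w i = (w k).+1 :> nat -> rect i k \subset Inv w.
Proof.
move=> w_inc w_av ik wik; apply/subsetP => -[x y].
rewrite mem_rect => /and4P[ix yk /eqP rx ry].
have xy : x < y by apply: reg_lt; rewrite rx.
have wix : w i <= w x by apply: increasing_le.
rewrite in_Inv xy /=.
have [ryk|rky] := ltnP (reg y) (reg k).
  have := w_av i y k ry ryk wik; have := @perm_neq _ w i y; lia.
have wyk : w y <= w k by apply: increasing_le => //; have := reg_mono yk; lia.
by lia.
Qed.

(** If i' < i then (i', k, k') would be a pattern; so i' = i, and hence
    k' = k. *)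
Lemma descents_rect w i k i' k' : increasing w -> avoiding w ->
    i < k -> w i = (w k).+1 :> nat -> w i' = (w k').+1 :> nat ->
  (i, k) \in rect i' k' -> (i, k) = (i', k').
Proof.
move=> w_inc w_av ik wik wik'; rewrite mem_rect => /and4P[i'i kk' /eqP ri rk].
have wi'i : w i' <= w i by apply: increasing_le.
have [iE|iNi'] := eqVneq i i'.
  have wk : w k = w k' by apply: val_inj => /=; rewrite iE in wik; lia.
  by rewrite iE (perm_inj wk).
have := @perm_neq _ w i i'; rewrite (inj_eq val_inj) => /(_ iNi') wNi.
have rkk' := reg_mono kk'; have [rE|rk_lt] := leqP (reg k') (reg k).
  have : w k <= w k' by apply: increasing_le => //; lia.
  lia.
have := w_av i' k k' rk rk_lt wik'; have := @perm_neq _ w i' k; lia.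
Qed.

(** As long as w has a pattern (i, j, k), exchange the values at i and k: this
    removes only the inversion (i, k).  No avoiding v below w is lost.  Indeed v
    is controlled by its descent rectangles, and if one of them, [rect i' k'],
    contained (i, k), it would contain (i', j) too; but i' and i share their
    region, so [w i' <= w i < w j] and (i', j) is not an inversion of w. *)
Lemma exists_greatest_avoiding w : increasing w ->
  exists u, [/\ increasing u, avoiding u, Inv u \subset Inv w &
    forall v, increasing v -> avoiding v -> Inv v \subset Inv w ->
      Inv v \subset Inv u].
Proof.
have [m] := ubnP #|Inv w|; elim: m => // m IHm in w *; rewrite ltnS => wm w_inc.
pose bad (t : 'I_n * 'I_n * 'I_n) := let: (i, j, k) := t in
  [&& reg i < reg j, reg j < reg k, w i == (w k).+1 :> nat & w i < w j].
have [/existsP[[[i j] k] /and4P[rij rjk /eqP wik wij]]|/existsPn good] :=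
    boolP [exists t, bad t]; last first.
  exists w; split=> // i j k rij rjk wik.
  by have := good (i, j, k); rewrite /bad rij rjk wik eqxx /= -leqNgt.
have ik : i < k by apply: reg_lt; lia.
have InvE := Inv_tperm ik wik; set w' := (tperm i k * w)%g in InvE.
have ik_w : (i, k) \in Inv w by rewrite in_Inv ik wik /=.
have [||u [u_inc u_av uw' max_u]] := IHm w'.
- by rewrite InvE; apply: leq_trans wm; rewrite [leqRHS](cardsD1 (i, k)) ik_w.
- by move=> x y; rewrite InvE => /setD1P[_ /w_inc].
exists u; split=> // [|v v_inc v_av vw].
  by apply: (subset_trans uw'); rewrite InvE subsetDl.
apply: max_u => //; apply: Inv_sub_of_descents => // i' k' ik' vik'.
have sub_w := subset_trans (rect_descent v_inc v_av ik' vik') vw.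
rewrite InvE subsetD1 sub_w /=; apply/negP; rewrite mem_rect.
case/and4P=> i'i kk' /eqP ri ri'k.
have : (i', j) \in Inv w.
  apply: (subsetP sub_w); rewrite mem_rect leqnn eqxx -ri rij /= andbT.
  by have := reg_lt rjk; lia.
rewrite in_Inv => /andP[_ wji'].
by have := increasing_le w_inc i'i (esym ri); lia.
Qed.

(** A position l carrying a value strictly between [w k] and [w i] would
    give an inversion outside the rectangle: (l, k) if l < i, (i, l) if k < l, and
    one of the two if i < l < k, according to the region of l. *)
Lemma Inv_rect_descent w i k :
  reg i < reg k -> Inv w = rect i k -> w i = (w k).+1 :> nat.
Proof.
move=> rik InvE.
have : (i, k) \in Inv w by rewrite InvE corner_rect.
rewrite in_Inv => /andP[ik wki]; apply/eqP; rewrite eqn_leq wki andbT leqNgt.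
apply/negP => gap; have ltn : (w k).+1 < n by have := ltn_ord (w i); lia.
pose l := (w^-1)%g (Ordinal ltn).
have wl : w l = (w k).+1 :> nat by rewrite /l permKV.
have [li|il] := ltnP l i.
  have : (l, k) \in Inv w by rewrite in_Inv; lia.
  by rewrite InvE mem_rect; lia.
have [kl|lk] := ltnP k l.
  have : (i, l) \in Inv w by rewrite in_Inv; lia.
  by rewrite InvE mem_rect; lia.
have lNi : l != i by apply/eqP => E; rewrite E in wl; lia.
have lNk : l != k by apply/eqP => E; rewrite E in wl; lia.
rewrite -!val_eqE /= in lNi lNk.
have : (i, l) \in Inv w by rewrite in_Inv; lia.
have : (l, k) \in Inv w by rewrite in_Inv; lia.
by rewrite InvE !mem_rect; lia.
Qed.

Lemma rect_increasing w i k : Inv w = rect i k -> increasing w.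
Proof. by move=> InvE x y; rewrite InvE mem_rect => /and4P[_ _ /eqP->]. Qed.

Lemma rect_avoiding w i k : Inv w = rect i k -> avoiding w.
Proof.
move=> InvE x y z rxy ryz wxz; rewrite leqNgt; apply/negP => wxy.
have [xy yz] := (reg_lt rxy, reg_lt ryz).
have : (x, z) \in Inv w by rewrite in_Inv wxz; lia.
have : (y, z) \in Inv w by rewrite in_Inv; lia.
by rewrite InvE !mem_rect; lia.
Qed.

(** Within the region of i the values increase, and between the following
    region and k they cannot decrease either, as such an inversion would lie
    outside the rectangle.  So every pair of the rectangle is at least as far
    inverted as its corner (i, k). *)
Lemma rect_sub_of_corner w i k : increasing w ->
  Inv w \subset rect i k -> (i, k) \in Inv w -> rect i k \subset Inv w.
Proof.
move=> w_inc w_rect; rewrite in_Inv => /andP[ik wki].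
apply/subsetP => -[x y]; rewrite mem_rect => /and4P[ix yk /eqP rx ry].
have wix : w i <= w x by apply: increasing_le.
have xy : x < y by apply: reg_lt; rewrite rx.
have wyk : w y <= w k.
  have [/val_inj->|yNk] := eqVneq (y : nat) k; first exact: leqnn.
  rewrite leqNgt; apply/negP => wky.
  have /(subsetP w_rect) : (y, k) \in Inv w by rewrite in_Inv; lia.
  by rewrite mem_rect; lia.
by rewrite in_Inv; lia.
Qed.

End Regions.

(** The permutation exchanging the adjacent blocks of positions [i, p) and
    [p, k], each kept in increasing order. *)
Lemma exists_block_swap n (i k : 'I_n) p : i < p -> p <= k ->
  exists w : 'S_n,
    Inv w = [set q : 'I_n * 'I_n | (i <= q.1 < p) && (p <= q.2 <= k)].
Proof.
move=> ip pk.
pose f (l : 'I_n) : nat :=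
  if l < i then (l : nat) else if l < p then l + (k.+1 - p)
  else if l <= k then l - (p - i) else l.
have fn l : f l < n.
  by have := ltn_ord l; have := ltn_ord k; rewrite /f; do !case: ifP; lia.
pose g l := Ordinal (fn l).
have g_inj : injective g.
  move=> x y /(congr1 val) E; apply/eqP; rewrite -(inj_eq val_inj) /=.
  by move: E; rewrite /= /f; do !case: ifP; lia.
exists (perm g_inj); apply/setP => -[x y]; rewrite in_Inv inE !permE /= /f.
by do !case: ifP; lia.
Qed.

(** * The regions of a composition *)

Lemma psumS alpha a : psum alpha a.+1 = psum alpha a + nth 0 alpha a.
Proof.
rewrite /psum; have [lt_a|le_a] := ltnP a (size alpha).
  by rewrite (take_nth 0 lt_a) sumn_rcons.
by rewrite nth_default // addn0 !take_oversize // (leq_trans le_a).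
Qed.

Lemma leq_psum alpha a b : a <= b -> psum alpha a <= psum alpha b.
Proof.
move=> /subnKC <-; elim: (b - a) => [|c IHc]; first by rewrite addn0.
by rewrite addnS psumS (leq_trans IHc) ?leq_addr.
Qed.

Lemma leq_reshape_index alpha a i : i < sumn alpha ->
  (a <= reshape_index alpha i) = (psum alpha a <= i).
Proof.
move=> i_lt; have offset_lt := reshape_offsetP i_lt.
have iE : psum alpha (reshape_index alpha i) + reshape_offset alpha i = i.
  by rewrite -[RHS](reshape_indexK alpha).
have [le_a|gt_a] := leqP; first by have := leq_psum alpha le_a; lia.
by have := leq_psum alpha gt_a; rewrite psumS; lia.
Qed.

Section ParabolicTamari.
Variables (n : nat) (alpha : seq nat).
Hypothesis alpha_comp : is_composition n alpha.

Let sum_alpha : sumn alpha = n.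
Proof. by case/andP: alpha_comp => _ /eqP. Qed.

Definition reg (i : 'I_n) := reshape_index alpha i.

Lemma leq_reg a (i : 'I_n) : (a <= reg i) = (psum alpha a <= i).
Proof. by rewrite leq_reshape_index // sum_alpha. Qed.

Lemma reg_size (i : 'I_n) : reg i < size alpha.
Proof. by apply: reshape_indexP; rewrite sum_alpha. Qed.

Lemma reg_mono (i k : 'I_n) : i <= k -> reg i <= reg k.
Proof. by move=> ik; rewrite leq_reg (leq_trans _ ik) // -leq_reg. Qed.

Lemma mem_region a (i : 'I_n) : (i \in region alpha a) = (reg i == a).
Proof. by rewrite inE -leq_reg ltnNge -leq_reg -ltnNge ltnS eqn_leq andbC. Qed.

Lemma different_regionsE (i j : 'I_n) :
  different_regions alpha i j = (reg i != reg j).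
Proof.
apply/forallP/idP => [/(_ (Ordinal (reg_size i)))|rij a].
  by rewrite !mem_region eqxx eq_sym.
by rewrite !mem_region; apply: contra rij => /andP[/eqP-> /eqP->].
Qed.

(** The interior partial sums are exactly the positions that start a new
    region. *)
Lemma mem_boundaries (i j : 'I_n) : j = i.+1 :> nat ->
  (val j \in [seq psum alpha a | a <- iota 1 (size alpha).-1]) =
    (reg i != reg j).
Proof.
move=> jE; have le_ij : reg i <= reg j by apply: reg_mono; rewrite jE.
have := reg_size j; have := leq_reg (reg j) j; have := leq_reg (reg j) i.
rewrite leqnn => ri rj r_size.
apply/mapP/idP => [[a]|rij].
  rewrite mem_iota /= => a_bounds ja.
  by have := leq_reg a i; have := leq_reg a j; rewrite -ja jE; lia.
by exists (reg j); [rewrite mem_iota | rewrite /=]; lia.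
Qed.

Lemma parabolicP (w : 'S_n) : parabolic alpha w <-> increasing reg w.
Proof.
split=> [/forallP w_par i k|w_inc]; last first.
  apply/forallP => i; apply/forallP => j; apply/implyP => /andP[/eqP jE].
  rewrite (mem_boundaries jE) negbK => /eqP rij.
  rewrite ltnNge; apply/negP => wji.
  have := @perm_neq _ w i j; have := w_inc i j; rewrite in_Inv rij jE; lia.
rewrite in_Inv ltnNge => /andP[ik wki]; rewrite ltnNge; apply/negP => rki.
suff step m (j : 'I_n) : j = i + m :> nat -> j <= k -> w i <= w j.
  by have := step (k - i) k; lia.
elim: m j => [|m IHm] j jE jk.
  by rewrite addn0 in jE; rewrite (val_inj jE).
have ltn : i + m < n by have := ltn_ord j; lia.
pose l := Ordinal ltn; have jl : j = l.+1 :> nat by rewrite /= jE addnS.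
have wil : w i <= w l by apply: IHm => //=; lia.
apply: leq_trans wil (ltnW _).
have /forallP/(_ j)/implyP := w_par l; apply.
rewrite (mem_boundaries jl) jl eqxx negbK.
have := @reg_mono i l; have := @reg_mono l j; have := @reg_mono j k.
by rewrite jl /=; lia.
Qed.

Lemma avoids231P (w : 'S_n) : avoids231 alpha w <-> avoiding reg w.
Proof.
split=> [/forallP w_av i j k rij rjk wik|w_av].
  have /forallP/(_ j)/forallP/(_ k) := w_av i.
  have := reg_lt reg_mono rij; have := reg_lt reg_mono rjk.
  by rewrite /pattern231 !different_regionsE; lia.
apply/forallP => i; apply/forallP => j; apply/forallP => k.
rewrite /pattern231 !different_regionsE; apply/negP.
case/and5P=> ij jk rij rjk /and4P[_ _ wij /eqP wik].
have := w_av i j k; have := @reg_mono i j; have := @reg_mono j k; lia.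
Qed.

Lemma Tam_inc (x : Tam n alpha) : increasing reg x.
Proof. by apply/parabolicP; case: x => /= w /andP[]. Qed.

Lemma Tam_avoid (x : Tam n alpha) : avoiding reg x.
Proof. by apply/avoids231P; case: x => /= w /andP[]. Qed.

Lemma exists_Tam (w : 'S_n) : increasing reg w -> avoiding reg w ->
  exists x : Tam n alpha, val x = w.
Proof.
move=> /parabolicP w_inc /avoids231P w_av.
have w_ok : parabolic alpha w && avoids231 alpha w by rewrite w_inc.
by exists (MkTam w_ok).
Qed.

Lemma leTam (x y : Tam n alpha) : (x <= y)%O = (Inv x \subset Inv y).
Proof. by []. Qed.

(** * Join irreducibles of Tam(alpha) *)

(** The role of a lower cover of x obtained by undoing the descent (i, k): all
    that is needed is a greatest element among those below x that do not invert
    i and k. *)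
Lemma Tam_below_swap (x : Tam n alpha) (i k : 'I_n) :
    i < k -> x i = (x k).+1 :> nat ->
  exists2 u : Tam n alpha, Inv u \subset Inv x :\ (i, k) &
    forall y : Tam n alpha, Inv y \subset Inv x :\ (i, k) -> (y <= u)%O.
Proof.
move=> ik xik; have InvE := Inv_tperm ik xik.
have [|u [u_inc u_av u_le u_max]] := exists_greatest_avoiding reg_mono
  (w := (tperm i k * x)%g).
  by move=> s t; rewrite InvE => /setD1P[_]; apply: Tam_inc.
have [v vE] := exists_Tam u_inc u_av.
rewrite InvE -vE in u_le u_max; exists v => // y y_le.
by rewrite leTam; apply: u_max => //; [apply: Tam_inc | apply: Tam_avoid].
Qed.

(** All elements strictly below x avoid inverting the corner (i, k), hence
    share the upper bound u given by [Tam_below_swap], which is not above x. *)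
Lemma rect_join_irreducible (x : Tam n alpha) (i k : 'I_n) :
  reg i < reg k -> Inv x = rect reg i k -> join_irreducible x.
Proof.
move=> rik InvE; have xik := Inv_rect_descent rik InvE.
have ik := reg_lt reg_mono rik.
have ik_x : (i, k) \in Inv x by rewrite InvE corner_rect.
have [u u_le u_max] := Tam_below_swap ik xik.
have xu : ~~ (x <= u)%O.
  rewrite leTam; apply: contraTN (ik_x) => x_u.
  by have := subset_trans x_u u_le; rewrite subsetD1 => /andP[].
have le_u y : (y <= x)%O -> x != y -> (y <= u)%O.
  move=> yx xy; apply: u_max; rewrite subsetD1 -leTam yx /=.
  apply: contraNN xy => ik_y; rewrite Order.POrderTheory.eq_le yx andbT leTam.
  rewrite InvE; apply: (rect_sub_of_corner reg_mono) => //.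
    exact: Tam_inc.
  by rewrite -InvE -leTam.
apply/andP; split.
  by apply/forallPn; exists u.
apply/'forall_forallP => a b; apply/implyP => /and3P[ax bx /forallP/(_ u)].
rewrite (negPf xu) implybF => ab_u; apply: contraNT ab_u.
by rewrite negb_or => /andP[xa xb]; rewrite !le_u.
Qed.

Lemma exists_rect (i k : 'I_n) : reg i < reg k ->
  exists x : Tam n alpha, Inv x = rect reg i k.
Proof.
move=> rik; have regP := leq_reg (reg i).+1.
have ip : i < psum alpha (reg i).+1 by rewrite ltnNge -regP ltnn.
have pk : psum alpha (reg i).+1 <= k by rewrite -regP.
have [w wE] := exists_block_swap ip pk.
have InvE : Inv w = rect reg i k.
  rewrite wE; apply/setP => -[x y]; rewrite mem_rect inE /= -regP ltnNge -regP.
  have := @reg_mono i x; have := @reg_mono x i; lia.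
have [x xE] := exists_Tam (rect_increasing InvE) (rect_avoiding reg_mono InvE).
by exists x; rewrite -InvE -xE.
Qed.

(** Without any descent x would be the least element.  With a second descent
    (i', k') it would be the join of the two elements obtained from
    [Tam_below_swap] for (i, k) and for (i', k'), since each descent rectangle is
    below one of them; so (i, k) is the only descent, and its rectangle already
    generates all inversions of x. *)
Lemma join_irreducible_rect (x : Tam n alpha) : join_irreducible x ->
  exists i k : 'I_n, reg i < reg k /\ Inv x = rect reg i k.
Proof.
case/andP=> x_least /forallP x_join.
pose descents := [set p : 'I_n * 'I_n |
  (p.1 < p.2) && (x p.1 == (x p.2).+1 :> nat)].
have descP i k : (i, k) \in descents -> [/\ i < k, x i = (x k).+1 :> nat,
    reg i < reg k & rect reg i k \subset Inv x].
  rewrite inE /= => /andP[ik /eqP xik]; split=> //.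
    by apply: (@Tam_inc x); rewrite in_Inv xik ik /=.
  by apply: (rect_descent reg_mono) => //; [apply: Tam_inc | apply: Tam_avoid].
have x_le (w : 'S_n) :
    (forall i k, (i, k) \in descents -> rect reg i k \subset Inv w) ->
    Inv x \subset Inv w.
  move=> w_ge; apply: (Inv_sub_of_descents reg_mono (@Tam_inc x) (@Tam_avoid x)).
  by move=> i k ik xik; apply: w_ge; rewrite inE /= ik xik eqxx.
have below_x i k : (i, k) \in descents -> exists u : Tam n alpha,
    [/\ (u <= x)%O, x != u & forall i' k', (i', k') \in descents ->
      (i', k') != (i, k) -> rect reg i' k' \subset Inv u].
  move=> dik; have [ik xik rik _] := descP _ _ dik.
  have [u u_le u_max] := Tam_below_swap ik xik.
  have ux : (u <= x)%O by rewrite leTam (subset_trans u_le) ?subsetDl.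
  exists u; split=> // [|i' k' d' dNd'].
    apply: contraTneq u_le => <-; rewrite subsetD1 negb_and negbK.
    by rewrite in_Inv ik xik ltnSn orbT.
  have [ik' xik' rik' ik_x'] := descP _ _ d'.
  have [z zE] := exists_rect rik'.
  rewrite -zE -leTam; apply: u_max; rewrite zE subsetD1 ik_x' /=.
  apply: contra dNd' => ik_rect; apply/eqP/esym.
  exact: (descents_rect reg_mono (@Tam_inc x) (@Tam_avoid x) ik).
have /forallPn[y /negP x_y] := x_least.
have [desc0|[[i k] dik]] := set_0Vmem descents.
  by case: x_y; apply: x_le => i k; rewrite desc0 inE.
have [ik xik rik ik_x] := descP _ _ dik.
exists i, k; split=> //; apply/eqP; rewrite eqEsubset ik_x andbT.
have [z zE] := exists_rect rik; rewrite -zE; apply: (x_le) => i' k' d'.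
rewrite zE; have [[-> ->] //|dNd'] := eqVneq (i', k') (i, k).
have [ik' xik' rik' ik_x'] := descP _ _ d'; exfalso.
have [u [u_lt xu u_ge]] := below_x i k dik.
have [v [v_lt xv v_ge]] := below_x i' k' d'.
have : is_join x u v.
  apply/and3P; split=> //; apply/forallP => t; apply/implyP => /andP[ut vt].
  rewrite leTam; apply: x_le => s r dsr.
  have [srE|srN] := eqVneq (s, r) (i, k).
    by apply: subset_trans vt; apply: v_ge => //; rewrite srE eq_sym.
  by apply: subset_trans ut; apply: u_ge.
move/forallP/(_ v)/implyP: (x_join u) => H /H.
by rewrite (negPf xu) (negPf xv).
Qed.

(** * Components of the poset of join irreducibles *)

Local Notation JIT := (JI (Tam n alpha)).

Definition component (j : nat) : {set JIT} :=
  [set x : JIT | [exists i : 'I_n, exists k : 'I_n,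
    [&& reg i == j, reg i < reg k & Inv (val (val x)) == rect reg i k]]].

Lemma componentP j (x : JIT) :
  reflect (exists i k : 'I_n,
             [/\ reg i = j, reg i < reg k & Inv (val (val x)) = rect reg i k])
          (x \in component j).
Proof.
rewrite inE; apply: (iffP existsP) => [[i /existsP[k]]|[i [k [<- rik InvE]]]].
  by case/and3P=> /eqP rij rik /eqP InvE; exists i, k.
by exists i; apply/existsP; exists k; rewrite eqxx rik InvE eqxx.
Qed.

Lemma leJI (x y : JIT) :
  (x <= y)%O = (Inv (val (val x)) \subset Inv (val (val y))).
Proof. by []. Qed.

Lemma exists_JI (i k : 'I_n) : reg i < reg k ->
  exists x : JIT, Inv (val (val x)) = rect reg i k.
Proof.
move=> rik; have [x xE] := exists_rect rik.
by exists (MkJI (rect_join_irreducible rik xE)).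
Qed.

Lemma JI_in_component (x : JIT) :
  exists j : 'I_(size alpha).-1, x \in component j.
Proof.
have [i [k [rik InvE]]] := join_irreducible_rect (valP x).
have ltj : reg i < (size alpha).-1 by have := reg_size k; lia.
by exists (Ordinal ltj); apply/componentP; exists i, k.
Qed.

Lemma component_le (x y : JIT) j j' :
  x \in component j -> y \in component j' -> (x <= y)%O -> j = j'.
Proof.
move=> /componentP[i [k [<- rik xE]]] /componentP[i' [k' [<- rik' yE]]].
rewrite leJI xE yE => /subsetP/(_ (i, k)).
by rewrite corner_rect rik mem_rect => /(_ isT)/and4P[_ _ /eqP].
Qed.

Lemma component_comparable (x y : JIT) j :
  (x >=< y)%O -> x \in component j -> y \in component j.
Proof.
have [j' yj'] := JI_in_component y => xy xj.
suff -> : j = j' by [].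
case/orP: xy => [xy|yx]; first exact: component_le xj yj' xy.
by rewrite (component_le yj' xj yx).
Qed.

(** Two rectangles of the same component lie in a common third one, with the
    smaller left end and the larger right end. *)
Lemma component_connected (x y : JIT) j :
  x \in component j -> y \in component j ->
  connect (fun x y => (x >=< y)%O) x y.
Proof.
move=> /componentP[i [k [rij rik xE]]] /componentP[i' [k' [ri'j rik' yE]]].
have [l [li li' rl]] : exists l : 'I_n, [/\ l <= i, l <= i' & reg l = j].
  by have [ii'|/ltnW i'i] := leqP i i'; [exists i | exists i'].
have [m [km k'm rm]] : exists m : 'I_n, [/\ k <= m, k' <= m & j < reg m].
  have [kk'|/ltnW k'k] := leqP k k'; first by exists k'; rewrite -?ri'j.
  by exists k; rewrite -?rij.
have [|z zE] := @exists_JI l m; first by rewrite rl.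
have xz : (x <= z)%O by rewrite leJI xE zE rect_subset ?li // rij rl.
have yz : (y <= z)%O by rewrite leJI yE zE rect_subset ?li' // ri'j rl.
by apply: (@connect_trans _ _ z); apply: connect1; apply/orP; [left|right].
Qed.

Lemma component_class (x : JIT) j : x \in component j ->
  [set y in [set: JIT] | connect (fun x y => (x >=< y)%O) x y] = component j.
Proof.
move=> xj; apply/setP => y; rewrite in_set in_setT /=; apply/idP/idP.
  case/connectP=> p path_p ->; elim: p x xj path_p => //= z p IHp x xj /andP[xz].
  by apply: IHp; apply: component_comparable xj.
exact: component_connected.
Qed.

Lemma component_neq0 (j : 'I_(size alpha).-1) : exists x, x \in component j.
Proof.
have [alpha_pos _] := andP alpha_comp; have jlt := ltn_ord j.
have part_pos a : a < size alpha -> 0 < nth 0 alpha a.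
  by move=> lt_a; apply: (allP alpha_pos); apply: mem_nth.
have nE : psum alpha (size alpha) = n by rewrite /psum take_size.
have posj := part_pos j; have posj1 := part_pos j.+1.
have le_n := @leq_psum alpha j.+2 (size alpha).
have psj := psumS alpha j; have psj1 := psumS alpha j.+1.
have ilt : psum alpha j < n by lia.
have klt : psum alpha j.+1 < n by lia.
have ri : reg (Ordinal ilt) = j.
  by apply/eqP; rewrite -mem_region inE /=; lia.
have rk : reg (Ordinal klt) = j.+1.
  by apply/eqP; rewrite -mem_region inE /=; lia.
have [|x xE] := @exists_JI (Ordinal ilt) (Ordinal klt); first by rewrite ri rk.
by exists x; apply/componentP; exists (Ordinal ilt), (Ordinal klt); rewrite ri rk.
Qed.

(** The pair (s, t) corresponds to the rectangle whose corner is the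
    (s+1)-st position from the right in region j and the (t+1)-st position after
    that region. *)
Lemma component_grid (j : 'I_(size alpha).-1) :
  isomorphic_to_subset
    ('I_(nth 0 alpha j) *p 'I_(sumn (drop j.+1 alpha))) (component j).
Proof.
have nE : psum alpha j.+1 + sumn (drop j.+1 alpha) = n.
  by rewrite /psum -sumn_cat cat_take_drop.
have pE := psumS alpha j.
have corners (st : 'I_(nth 0 alpha j) *p 'I_(sumn (drop j.+1 alpha))) :
    exists ik : 'I_n * 'I_n, [/\ ik.1 + st.1 + 1 = psum alpha j.+1,
      ik.2 = psum alpha j.+1 + st.2 :> nat, reg ik.1 = j & reg ik.1 < reg ik.2].
  case: st => s t; have ltt := ltn_ord t; have lts := ltn_ord s.
  have ilt : psum alpha j.+1 - s.+1 < n by lia.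
  have klt : psum alpha j.+1 + t < n by lia.
  have ri : reg (Ordinal ilt) = j.
    by apply/eqP; rewrite -mem_region inE /=; lia.
  exists (Ordinal ilt, Ordinal klt); split=> //=; first by lia.
  by rewrite ri leq_reg /= leq_addr.
have [c cP] := fin_all_exists corners.
have [f fE] := fin_all_exists
  (fun st => let: And4 _ _ _ r := cP st in exists_JI r).
exists f; split=> [st st'|].
  have [i1 k1 ri r] := cP st; have [i1' k1' ri' r'] := cP st'.
  rewrite leJI !fE (rect_subset _ r) ?ri ?ri' // leEprod !leEord /=.
  move=> {fE f ri ri' r r'}.
  case: (c st) i1 k1 => i k /= i1 k1; case: (c st') i1' k1' => i' k' /= i1' k1'.
  case: st i1 k1 => [s t] /= i1 k1; case: st' i1' k1' => [s' t'] /= i1' k1'.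
  lia.
apply/setP => x; apply/imsetP/componentP => [[st _ ->]|[i [k [ri rik xE]]]].
  by exists (c st).1, (c st).2; have [_ _ ri r] := cP st.
have jP : psum alpha j <= i by rewrite -leq_reg ri.
have iP : i < psum alpha j.+1 by rewrite ltnNge -leq_reg ri ltnn.
have kP : psum alpha j.+1 <= k by rewrite -leq_reg -ri.
have slt : psum alpha j.+1 - i.+1 < nth 0 alpha j by lia.
have tlt : k - psum alpha j.+1 < sumn (drop j.+1 alpha) by have := ltn_ord k; lia.
exists (Ordinal slt, Ordinal tlt) => //; apply/val_inj/val_inj/Inv_inj.
have [/= i1 k1 _ _] := cP (Ordinal slt, Ordinal tlt); rewrite fE xE.
by congr rect; apply: val_inj => /=; lia.
Qed.

End ParabolicTamari.

Theorem theorem1p4 (n : nat) (alpha : seq nat)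
    (n_gt0 : 0 < n) (alpha_comp : is_composition n alpha) :
  exists C : 'I_(size alpha).-1 -> {set JI (Tam n alpha)},
    [/\ injective C,
        components (JI (Tam n alpha)) = [set C j | j : 'I_(size alpha).-1]
      & forall j : 'I_(size alpha).-1,
          isomorphic_to_subset
            ('I_(nth 0 alpha j) *p 'I_(sumn (drop j.+1 alpha))) (C j)].
Proof.
exists (fun j : 'I_(size alpha).-1 => component n alpha j); split.
- move=> j j' jj'; have [x xj] := component_neq0 alpha_comp j; apply: val_inj.
  have xj' : x \in component n alpha j' by rewrite -jj'.
  exact: component_le xj xj' (Order.POrderTheory.lexx x).
- apply/setP => A; apply/imsetP/imsetP => [[x _ ->]|[j _ ->]].
    have [j xj] := JI_in_component alpha_comp x; exists j => //.
    exact: component_class.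
  have [x xj] := component_neq0 alpha_comp j; exists x => //.
  by rewrite (component_class alpha_comp xj).
- exact: component_grid.
Qed.
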